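(* Let $\sigma=5-2\sqrt6$ and for $k\ge1$ let $$\beta_k=\frac{3}{\sqrt6}\left(4+\frac53\sqrt6\right)\frac{1}{k+1}\binom{2k}{k}\left(\frac1{12}\right)^k,$$ so that $(\beta_k)_{k\ge1}$ is a probability distribution on the positive integers. Let $Y_1,\dots,Y_m$ be i.i.d. integer random variables with $P(Y_i=k)=\beta_k$. Let $\gamma=\gamma(m)$ be such that $m\gamma^{-3/2}3^{-\gamma}/(\sigma\sqrt\pi)=1$. Then, as $m\to\infty$, $$P\big(\max\{Y_1,\dots,Y_m\}<x+\gamma(m)\big)\sim\exp\left(-3^{1-x}/2\right)$$ uniformly for $|x|$ bounded with $x+\gamma(m)$ an integer. *)

(* Defs.v *)
From HB Require Import structures.
From mathcomp Require Export all_boot all_order all_algebra.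
From mathcomp Require Export all_classical all_reals all_analysis.
Set Implicit Arguments.
Unset Strict Implicit.
Unset Printing Implicit Defensive.
Import Order.TTheory GRing.Theory Num.Theory.
Import numFieldNormedType.Exports.
Local Open Scope classical_set_scope.
Local Open Scope ring_scope.

Definition sigma (R : realType) : R := 5 - 2 * Num.sqrt 6.

Definition beta (R : realType) (k : nat) : R :=
  3 / Num.sqrt 6 * (4 + 5 / 3 * Num.sqrt 6)
  * (1 / k.+1%:R) * 'C(2 * k, k)%:R * (1 / 12) ^+ k.

Definition mutually_independent (R : realType) (d : measure_display)
    (T : measurableType d) (P : probability T R) (I : finType)
    (X : I -> {RV P >-> R}) : Prop :=
  forall (J : {set I}) (A : I -> set R),
    (forall i, i \in J -> measurable (A i)) ->
    P (\bigcap_(i in [set` J]) (X i @^-1` A i)) =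
    (\prod_(i in J) P (X i @^-1` A i))%E.

(* Extended-real valued, so that the maximum of the empty family is -oo. *)
Definition max_RV (R : realType) (d : measure_display)
    (T : measurableType d) (P : probability T R) (m : nat)
    (X : 'I_m -> {RV P >-> R}) (t : T) : \bar R :=
  \big[maxe/-oo%E]_(i < m) (X i t)%:E.

(* Main.v *)
Require Import Defs.
From mathcomp Require Import ring lra zify.
Set Implicit Arguments.
Unset Strict Implicit.
Unset Printing Implicit Defensive.
Import Order.TTheory GRing.Theory Num.Theory.
Import numFieldNormedType.Exports.
Local Open Scope classical_set_scope.
Local Open Scope ring_scope.

(* With [C_k] the Catalan numbers, [beta k = C_k / (sigma 12^k)], and the convolution
   identity for [C_k] makes [sum_k C_k z^k] the smaller root of [x = 1 + z x^2], which
   is [6 - 2 sqrt 6 = 1 + sigma] at [z = 1/12].  Wallis' integrals give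
   [C_k ~ 4^k / (k^(3/2) sqrt pi)], and the ratios [beta (k+1) / beta k] increase to
   [1/3], so the tail [q n = P(Y >= n)] is asymptotic to [(3/2) beta n].  By
   independence [P(max < n) = (1 - q n)^m]; the choice of [gamma] turns [m q n] with
   [n = x + gamma] into [3^(1-x)/2 (1 + o(1))], and
   [exp (- q / (1 - q)) <= 1 - q <= exp (- q)] concludes. *)

(** * Catalan numbers *)

Definition catalan (R : realType) (k : nat) : R := 'C(2 * k, k)%:R / k.+1%:R.

Lemma catalan0 (R : realType) : catalan R 0 = 1.
Proof. by rewrite /catalan muln0 bin0 divr1. Qed.

Lemma central_binS (k : nat) :
  (k.+1 * 'C(2 * k.+1, k.+1) = 2 * (2 * k).+1 * 'C(2 * k, k))%N.
Proof.
have -> : (2 * k.+1 = (2 * k).+2)%N by lia.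
have h1 : ((2 * k).+2 * 'C((2 * k).+1, k) = k.+1 * 'C((2 * k).+2, k.+1))%N.
  exact: mul_bin_diag.
have h2 : ((2 * k).+1 * 'C(2 * k, k) = k.+1 * 'C((2 * k).+1, k.+1))%N.
  exact: mul_bin_diag.
have h3 : 'C((2 * k).+1, k.+1) = 'C((2 * k).+1, k).
  apply/eqP; rewrite -(eqn_pmul2l (ltn0Sn k)) mul_bin_left.
  by have -> : ((2 * k).+1 - k = k.+1)%N by lia.
by rewrite -h1 -h3; lia.
Qed.

(** This recurrence drives the convolution identity, the link with Wallis' integrals and the ratio
    of consecutive [beta]. *)
Lemma catalanS (R : realType) (k : nat) :
  k.+2%:R * catalan R k.+1 = (4 * k%:R + 2) * catalan R k.
Proof.
rewrite /catalan.
have k2 : k.+2%:R != 0 :> R by rewrite pnatr_eq0.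
have k1 : k.+1%:R != 0 :> R by rewrite pnatr_eq0.
rewrite mulrC divfK //.
apply: (mulfI k1); rewrite -[LHS]natrM central_binS !natrM -(natr1 (2 * k)) natrM.
by field; rewrite -natr1 addrC in k1.
Qed.

Lemma catalan_gt0 (R : realType) (k : nat) : 0 < catalan R k.
Proof. by rewrite divr_gt0 ?ltr0n ?bin_gt0// leq_pmull. Qed.

Definition catalan_conv (R : realType) (n : nat) : R :=
  \sum_(i < n.+1) catalan R i * catalan R (n - i).

(* The weight [i + 1] is averaged with its mirror image [n - i + 1]. *)
Lemma catalan_conv_weight (R : realType) (n : nat) :
  \sum_(i < n.+1) (i%:R + 1) * (catalan R i * catalan R (n - i)) =
  (n%:R / 2 + 1) * catalan_conv R n.
Proof.
set S := LHS.
have SE : S = \sum_(i < n.+1) (n%:R - i%:R + 1) * (catalan R i * catalan R (n - i)).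
  rewrite /S (reindex_inj rev_ord_inj)/=; apply: eq_bigr => i _.
  have lein : (i <= n)%N by rewrite -ltnS.
  by rewrite subSS subKn// natrB// (mulrC (catalan R i)).
have : S + S = 2 * ((n%:R / 2 + 1) * catalan_conv R n).
  rewrite {2}SE /S -big_split/= /catalan_conv mulrA mulr_sumr.
  by apply: eq_bigr => i _; field.
by move=> h; lra.
Qed.

(* Weighting the convolution by [i + 1] and applying [catalanS] termwise gives
   [(n + 3) / 2 * conv (n + 1) = (2 n + 2) * conv n + C_(n + 1)]. *)
Lemma catalan_convE (R : realType) (n : nat) : catalan_conv R n = catalan R n.+1.
Proof.
elim: n => [|n IH].
  rewrite /catalan_conv big_ord1 subnn !catalan0 mulr1.
  by have := catalanS R 0; rewrite catalan0; lra.
have H : \sum_(i < n.+1) (i.+2%:R * catalan R i.+1) * catalan R (n - i) =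
    (2 * n%:R + 2) * catalan_conv R n.
  have -> : (2 * n%:R + 2) * catalan_conv R n =
     4 * ((n%:R / 2 + 1) * catalan_conv R n) - 2 * catalan_conv R n by field.
  rewrite -catalan_conv_weight /catalan_conv !mulr_sumr -sumrB.
  by apply: eq_bigr => i _; rewrite catalanS; ring.
have K := catalan_conv_weight R n.+1.
rewrite big_ord_recl/= subn0 catalan0 in K.
rewrite [X in _ + X](_ : _ = (2 * n%:R + 2) * catalan_conv R n) in K; last first.
  by rewrite -H; apply: eq_bigr => i _; rewrite /bump/= add1n subSS natr1 mulrA.
rewrite IH in K.
have := catalanS R n.+1.
have n3 : n.+3%:R != 0 :> R by rewrite pnatr_eq0.
move=> L; apply: (mulfI n3); rewrite L.
have e1 : n.+1%:R = n%:R + 1 :> R by rewrite natr1.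
have e3 : n.+3%:R = n%:R + 3 :> R by rewrite -addn3 natrD.
rewrite e3 e1 in K *.
lra.
Qed.

(** * Wallis' integrals *)

Definition wallis (R : realType) (n : nat) : R :=
  \int[lebesgue_measure]_(x in `[0, pi / 2]) (sin x ^+ n).

Lemma continuous_sinX (R : realType) (n : nat) : continuous (fun x : R => sin x ^+ n).
Proof.
move=> x; apply: (@continuous_comp _ _ _ (@sin R) (fun y => y ^+ n)).
  exact: continuous_sin.
exact: exprn_continuous.
Qed.

Lemma integrable_sinX (R : realType) (n : nat) :
  lebesgue_measure.-integrable `[0, pi / 2 : R] (EFin \o (fun x => sin x ^+ n)).
Proof.
apply: continuous_compact_integrable; first exact: segment_compact.
exact/continuous_subspaceT/continuous_sinX.
Qed.

Lemma wallis0 (R : realType) : wallis R 0 = pi / 2.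
Proof.
rewrite /wallis; under eq_Rintegral do rewrite expr0.
rewrite Rintegral_cst//= lebesgue_measure_itv/= lte_fin mul1r.
by rewrite divr_gt0 ?pi_gt0//= subr0.
Qed.

Lemma wallis1 (R : realType) : wallis R 1 = 1.
Proof.
rewrite /wallis; under eq_Rintegral do rewrite expr1.
rewrite /Rintegral (@continuous_FTC2 _ _ (fun x : R => - cos x)) /=.
- by rewrite cos_pihalf cos0 oppr0 sub0r opprK.
- by rewrite divr_gt0 ?pi_gt0.
- exact/continuous_subspaceT/continuous_sin.
- split.
  + move=> x _; exact/derivableN/derivable_cos.
  + apply: cvg_at_right_filter; apply: cvgN; exact: continuous_cos.
  + apply: cvg_at_left_filter; apply: cvgN; exact: continuous_cos.
- move=> x _; rewrite derive1E deriveN; last exact: derivable_cos.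
  by rewrite derive_val opprK.
Qed.

(** Integration by parts: [- cos * sin^(n+1)] vanishes at [0] and at [pi / 2], and its derivative is
    the difference of the two integrands. *)
Lemma wallisSS (R : realType) (n : nat) :
  n.+2%:R * wallis R n.+2 = n.+1%:R * wallis R n.
Proof.
pose F (x : R) := - (cos x * sin x ^+ n.+1).
have dF (x : R) : is_derive x 1 F (n.+2%:R * sin x ^+ n.+2 - n.+1%:R * sin x ^+ n).
  have -> : F = - (cos * (sin ^+ n.+1)).
    by apply/funext => y; rewrite /F -[RHS]/(- (cos y * (sin ^+ n.+1) y)) exprfctE.
  apply: is_derive_eq.
  rewrite /GRing.scale/= exprfctE.
  have c2 : cos x ^+ 2 = 1 - sin x ^+ 2 by rewrite -(cos2Dsin2 x) addrK.
  transitivity ((sin x ^+ 2 - n.+1%:R * cos x ^+ 2) * sin x ^+ n).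
    by rewrite !exprS; ring.
  by rewrite c2 !exprS; ring.
have cF : continuous F.
  by move=> x; apply: differentiable_continuous; apply/derivable1_diffP; case: (dF x).
apply/eqP; rewrite -subr_eq0; apply/eqP.
rewrite /wallis -!RintegralZl//; [|exact: integrable_sinX..].
have intZ (c : R) (k : nat) :
    lebesgue_measure.-integrable `[0, pi / 2 : R] (EFin \o (fun x => c * sin x ^+ k)).
  apply: continuous_compact_integrable; first exact: segment_compact.
  by apply/continuous_subspaceT => x; apply: cvgMl_tmp; exact: continuous_sinX.
rewrite -RintegralB//.
rewrite /Rintegral (@continuous_FTC2 _ _ F) /=.
- by rewrite /F cos_pihalf sin0 mul0r exprS mul0r mulr0 subrr.
- by rewrite divr_gt0 ?pi_gt0.
- apply/continuous_subspaceT => x; apply: cvgB; apply: cvgMl_tmp; exact: continuous_sinX.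
- split.
  + move=> x _; by case: (dF x).
  + by apply: cvg_at_right_filter; exact: cF.
  + by apply: cvg_at_left_filter; exact: cF.
- by move=> x _; rewrite derive1E derive_val.
Qed.

Lemma wallis_anti (R : realType) (n : nat) : wallis R n.+1 <= wallis R n.
Proof.
apply: le_Rintegral => //; [exact: integrable_sinX..|].
move=> x /=; rewrite in_itv/= => /andP[x0 x1].
have s0 : 0 <= sin x by apply: sin_ge0_pi; rewrite x0/=; have := pi_gt0 R; lra.
by rewrite exprS ler_piMl ?exprn_ge0 ?sin_le1.
Qed.

Lemma wallis_gt0 (R : realType) (n : nat) : 0 < wallis R n.
Proof.
suff : 0 < wallis R n /\ 0 < wallis R n.+1 by case.
elim: n => [|n [h0 h1]].
  by rewrite wallis0 wallis1 divr_gt0 ?pi_gt0.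
split=> //; have := wallisSS R n; rewrite -(pmulr_rgt0 (x := n.+2%:R)) ?ltr0n// => ->.
by rewrite mulr_gt0 ?ltr0n.
Qed.

(** By [wallisSS] the product does not change from [n] to [n + 1]. *)
Lemma wallis_mul (R : realType) (n : nat) :
  n.+1%:R * wallis R n * wallis R n.+1 = pi / 2.
Proof.
elim: n => [|n IH]; first by rewrite wallis0 wallis1 mul1r mulr1.
by rewrite mulrAC wallisSS -IH; ring.
Qed.

(** The factor [(k + 1) C_k / 4^k] is the normalised central binomial coefficient; [wallisSS] and
    [catalanS] give both sides the same recurrence. *)
Lemma wallis_catalan (R : realType) (k : nat) :
  wallis R (2 * k) = pi / 2 * (k.+1%:R * catalan R k / 4 ^+ k).
Proof.
elim: k => [|k IH]; first by rewrite muln0 wallis0 catalan0 expr0 divr1 !mulr1.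
have n2 : (2 * k).+2%:R != 0 :> R by rewrite pnatr_eq0.
have -> : (2 * k.+1 = (2 * k).+2)%N by lia.
apply: (mulfI n2); rewrite wallisSS IH catalanS.
have -> : (2 * k).+2%:R = 2 * k%:R + 2 :> R by rewrite -addn2 natrD natrM.
rewrite -!natr1 natrM exprS; field.
by rewrite expf_neq0// pnatr_eq0.
Qed.

(** Since [wallis] is nonincreasing, the square of [wallis (2 k)] lies between its products with
    [wallis (2 k + 1)] and [wallis (2 k - 1)], which [wallis_mul] evaluates. *)
Lemma catalan_wallis_bounds (R : realType) (k : nat) :
  2 * k%:R / (2 * k%:R + 1) <= pi * k%:R * (k.+1%:R * catalan R k / 4 ^+ k) ^+ 2 <= 1.
Proof.
set A := _ / _ ^+ k.
have p0 := pi_gt0 R.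
have W0 := wallis_gt0 R (2 * k).
have WE := wallis_catalan R k; rewrite -/A in WE.
have A0 : 0 < A by rewrite divr_gt0 ?exprn_gt0// mulr_gt0 ?ltr0n ?catalan_gt0.
have k0 : 0 <= k%:R :> R by rewrite ler0n.
apply/andP; split.
  have : (2 * k%:R + 1) * wallis R (2 * k) * wallis R (2 * k) >= pi / 2.
    rewrite -(wallis_mul R (2 * k)) -natr1 natrM.
    by rewrite ler_wpM2l ?wallis_anti// mulr_ge0 ?(ltW W0)//; lra.
  rewrite WE => H.
  have H' : 1 <= (2 * k%:R + 1) * (pi / 2 * A ^+ 2).
    rewrite -(ler_pM2l (x := pi / 2)) ?divr_gt0// mulr1; apply: le_trans H _.
    by rewrite le_eqVlt; apply/orP; left; apply/eqP; ring.
  rewrite ler_pdivrMr; last by lra.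
  have -> : pi * k%:R * A ^+ 2 * (2 * k%:R + 1) =
     2 * k%:R * ((2 * k%:R + 1) * (pi / 2 * A ^+ 2)) by field.
  by rewrite ler_peMr// mulr_ge0.
(* The upper bound uses the index [2 k - 1], hence the separate case [k = 0]. *)
have [k00|kpos] := posnP k; first by rewrite {1}k00 mulr0 mul0r.
have pk : (0 < 2 * k)%N by lia.
have := wallis_mul R (2 * k).-1; have := wallis_anti R (2 * k).-1.
rewrite prednK// => H1 H2.
have H : k%:R * 2 * wallis R (2 * k) * wallis R (2 * k) <= pi / 2.
  rewrite -H2 [in leRHS]natrM [in leRHS](mulrC 2).
  by rewrite ler_wpM2r ?(ltW W0)// ler_wpM2l// mulr_ge0.
rewrite -(ler_pM2l (x := pi / 2)) ?divr_gt0// mulr1; apply: le_trans H.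
by rewrite WE le_eqVlt; apply/orP; left; apply/eqP; field.
Qed.

(** * The Catalan series *)

Definition catalan_series (R : realType) (z : R) (n : nat) : R :=
  \sum_(i < n) catalan R i * z ^+ i.

Lemma catalan_seriesSr (R : realType) (z : R) (n : nat) :
  catalan_series z n.+1 = catalan_series z n + catalan R n * z ^+ n.
Proof. by rewrite /catalan_series big_ord_recr. Qed.

Lemma catalan_series0 (R : realType) (z : R) : catalan_series z 0 = 0.
Proof. by rewrite /catalan_series big_ord0. Qed.

Lemma catalan_series_homo (R : realType) (z : R) : 0 <= z ->
  {homo catalan_series z : m n / (m <= n)%N >-> m <= n}.
Proof.
move=> z0; apply: homo_leq => [//|x y t /le_trans|n]; first exact.
by rewrite catalan_seriesSr lerDl mulr_ge0 ?exprn_ge0// ltW ?catalan_gt0.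
Qed.

(** Truncation of [S = 1 + z S^2]: the sum on the right runs over the triangle of pairs with
    [i + j < n]. *)
Lemma catalan_seriesS (R : realType) (z : R) (n : nat) :
  catalan_series z n.+1 =
  1 + z * \sum_(i < n) catalan R i * z ^+ i * catalan_series z (n - i).
Proof.
elim: n => [|n IH].
  by rewrite catalan_seriesSr catalan_series0 big_ord0 mulr0 catalan0 mulr1 addrC.
rewrite catalan_seriesSr IH -addrA; congr (_ + _).
rewrite big_ord_recr/= -catalan_convE /catalan_conv mulr_suml.
rewrite big_ord_recr/= subnn subSnn exprS.
have -> : \sum_(i < n) catalan R i * z ^+ i * catalan_series z (n.+1 - i) =
    \sum_(i < n) catalan R i * z ^+ i * catalan_series z (n - i) +
    \sum_(i < n) catalan R i * catalan R (n - i) * z ^+ n.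
  rewrite -big_split/=; apply: eq_bigr => i _.
  rewrite subSn; last by rewrite ltnW.
  rewrite catalan_seriesSr.
  have -> : z ^+ n = z ^+ i * z ^+ (n - i) by rewrite -exprD subnKC// ltnW.
  ring.
rewrite catalan_seriesSr catalan_series0 catalan0 add0r expr0.
rewrite -!mulr_suml. set u := \sum_(i < n) _; set v := \sum_(i < n) _.
by rewrite !mulr1; ring.
Qed.

(** The triangle [i + j < n] lies inside the square [i, j < n]. *)
Lemma catalan_seriesS_le (R : realType) (z : R) (n : nat) : 0 <= z ->
  catalan_series z n.+1 <= 1 + z * catalan_series z n ^+ 2.
Proof.
move=> z0; rewrite catalan_seriesS lerD2l ler_wpM2l// expr2 {2}/catalan_series mulr_suml.
apply: ler_sum => i _; rewrite ler_wpM2l//.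
  by rewrite mulr_ge0 ?exprn_ge0// ltW ?catalan_gt0.
by apply: catalan_series_homo => //; exact: leq_subr.
Qed.

(** The square [i, j < n] lies inside the triangle [i + j < 2 n]. *)
Lemma catalan_series_ge (R : realType) (z : R) (n : nat) : 0 <= z ->
  1 + z * catalan_series z n ^+ 2 <= catalan_series z (2 * n).+1.
Proof.
move=> z0; rewrite catalan_seriesS lerD2l ler_wpM2l// expr2 {1}/catalan_series mulr_suml.
rewrite mul2n -addnn big_split_ord/=.
have c0 i : 0 <= catalan R i * z ^+ i by rewrite mulr_ge0 ?exprn_ge0// ltW ?catalan_gt0.
have S0 i : 0 <= catalan_series z i by apply: sumr_ge0.
rewrite ler_wpDr//; first by apply: sumr_ge0 => i _; rewrite mulr_ge0.
apply: ler_sum => i _; rewrite ler_wpM2l//; apply: catalan_series_homo => //.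
by rewrite -addnBA ?leq_addr// ltnW.
Qed.

(** The map [y -> 1 + z y^2] is monotone on nonnegative reals and fixes [x], so by
    [catalan_seriesS_le] it keeps the partial sums below [x]. *)
Lemma catalan_series_bounded (R : realType) (z x : R) (n : nat) : 0 <= z -> 0 <= x ->
  1 + z * x ^+ 2 = x -> catalan_series z n <= x.
Proof.
move=> z0 x0 xE; elim: n => [|n IH]; first by rewrite catalan_series0.
apply: le_trans (catalan_seriesS_le _ z0) _.
rewrite -[leRHS]xE lerD2l ler_wpM2l// lerXn2r// nnegrE//.
by apply: sumr_ge0 => i _; rewrite mulr_ge0 ?exprn_ge0// ltW ?catalan_gt0.
Qed.

(* The limit [l] satisfies [1 + z l^2 <= l <= x], and [2 z x < 1] makes [x] the
   smaller root of [1 + z x^2 = x]. *)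
Lemma catalan_series_cvg (R : realType) (z x : R) : 0 < z -> 0 <= x ->
  1 + z * x ^+ 2 = x -> 2 * z * x < 1 -> catalan_series z n @[n --> \oo] --> x.
Proof.
move=> z0 x0 xE zx.
have S_le n := catalan_series_bounded n (ltW z0) x0 xE.
have cvS : cvgn (catalan_series z).
  apply: nondecreasing_is_cvgn; first exact: catalan_series_homo (ltW z0).
  by exists x => _ [n _ <-].
set l := limn (catalan_series z).
have cvl : catalan_series z n @[n --> \oo] --> l by [].
have lx : l <= x by apply: limr_le => //; apply: nearW.
have Sl n : catalan_series z n <= l.
  by apply: nondecreasing_cvgn_le => //; exact: catalan_series_homo (ltW z0).
have Hl : 1 + z * l ^+ 2 <= l.
  have cv : 1 + z * catalan_series z n ^+ 2 @[n --> \oo] --> 1 + z * l ^+ 2.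
    apply: cvgD; first exact: cvg_cst.
    apply: cvgMl_tmp; rewrite expr2; under eq_fun do rewrite expr2.
    exact: cvgM.
  apply: (cvgr_to_le cv).
  by apply: nearW => n; apply: le_trans (Sl (2 * n).+1); apply: catalan_series_ge; exact: ltW.
suff -> : x = l by [].
apply/eqP; rewrite eq_le lx andbT leNgt; apply/negP => ltlx.
(* This product expands to [1 - (l - z l^2)], which [Hl] makes nonpositive: a contradiction. *)
have : 0 < (x - l) * (1 - z * (l + x)).
  rewrite mulr_gt0 ?subr_gt0//; apply: lt_trans zx.
  by rewrite -mulrA (mulrCA 2) ltr_pM2l// mulr_natl mulr2n ltrD2r.
rewrite [ltRHS](_ : _ = x - z * x ^+ 2 - (l - z * l ^+ 2)); last by ring.
lra.
Qed.

(** * The distribution [beta] and its tail *)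

Lemma sqrt6_bounds (R : realType) : [/\ 12 / 5 < Num.sqrt 6 :> R,
  Num.sqrt 6 < 5 / 2 :> R & Num.sqrt 6 ^+ 2 = 6 :> R].
Proof.
have s2 : Num.sqrt 6 ^+ 2 = 6 :> R by rewrite sqr_sqrtr.
have s0 : 0 <= Num.sqrt 6 :> R by rewrite sqrtr_ge0.
by split=> //; rewrite ltNge; apply/negP => h; nra.
Qed.

Lemma sigma_gt0 (R : realType) : 0 < sigma R.
Proof. by have [_ h _] := sqrt6_bounds R; rewrite /sigma; lra. Qed.

(** The prefactor of [beta] equals [5 + 2 sqrt 6], the conjugate of [sigma]; as [25 - 24 = 1], it is
    the inverse of [sigma]. *)
Lemma betaE (R : realType) (k : nat) :
  beta R k = catalan R k * (1 / 12) ^+ k / sigma R.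
Proof.
have [h1 h2 h3] := sqrt6_bounds R.
have s0 : Num.sqrt 6 != 0 :> R by apply/eqP; lra.
have -> : (sigma R)^-1 = 5 + 2 * Num.sqrt 6.
  apply: (mulfI (lt0r_neq0 (sigma_gt0 R))); rewrite mulfV ?lt0r_neq0 ?sigma_gt0//.
  by rewrite /sigma; lra.
rewrite /beta /catalan.
have -> : 3 / Num.sqrt 6 * (4 + 5 / 3 * Num.sqrt 6) = 5 + 2 * Num.sqrt 6 :> R.
  apply: (mulIf s0); rewrite mulrAC divfK//; lra.
by ring.
Qed.

Lemma beta_gt0 (R : realType) (k : nat) : 0 < beta R k.
Proof.
by rewrite betaE divr_gt0 ?sigma_gt0// mulr_gt0 ?catalan_gt0// exprn_gt0.
Qed.

Lemma betaS (R : realType) (k : nat) :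
  beta R k.+1 = beta R k * ((2 * k%:R + 1) / (6 * (k%:R + 2))).
Proof.
have k2 : k.+2%:R != 0 :> R by rewrite pnatr_eq0.
have cE := catalanS R k; rewrite -addn2 natrD in k2 cE.
have {}cE : catalan R k.+1 = (4 * k%:R + 2) * catalan R k / (k%:R + 2).
  by apply: (mulfI k2); rewrite [RHS]mulrC divfK.
rewrite !betaE cE exprS; field.
by rewrite k2 lt0r_neq0 ?sigma_gt0.
Qed.

(* [P(Y >= n)], written through the closed form [sum_k C_k / 12^k = 6 - 2 sqrt 6]. *)
Definition beta_tail (R : realType) (n : nat) : R :=
  (6 - 2 * Num.sqrt 6 - catalan_series (1 / 12) n) / sigma R.

Lemma beta_tailS (R : realType) (n : nat) :
  beta_tail R n - beta_tail R n.+1 = beta R n.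
Proof. by rewrite /beta_tail betaE catalan_seriesSr; ring. Qed.

(** Removing the term [C_0 = 1] from the full sum [1 + sigma] leaves [sigma]: the law starts at
    [k = 1]. *)
Lemma beta_tail1 (R : realType) : beta_tail R 1 = 1.
Proof.
rewrite /beta_tail catalan_seriesSr catalan_series0 catalan0 mulr1 add0r.
rewrite [X in X / _](_ : _ = sigma R) ?mulfV ?lt0r_neq0 ?sigma_gt0//.
by rewrite /sigma; ring.
Qed.

Lemma beta_tail_cvg (R : realType) : beta_tail R n @[n --> \oo] --> 0.
Proof.
have [h1 h2 h3] := sqrt6_bounds R.
have h : catalan_series (1 / 12 : R) n @[n --> \oo] --> 6 - 2 * Num.sqrt 6.
  by apply: catalan_series_cvg; lra.
have -> : 0 = (6 - 2 * Num.sqrt 6 - (6 - 2 * Num.sqrt 6)) / sigma R :> R.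
  by rewrite subrr mul0r.
apply: cvgMr_tmp; apply: cvgB => //; exact: cvg_cst.
Qed.

Lemma beta_cvg (R : realType) : beta R n @[n --> \oo] --> 0.
Proof.
under eq_fun do rewrite -beta_tailS.
rewrite -(subrr 0); apply: cvgB; first exact: beta_tail_cvg.
by rewrite (cvg_shiftS (beta_tail R)); exact: beta_tail_cvg.
Qed.

(** The difference [v - u] is nonincreasing with limit [0], hence nonnegative. This lets tails be
    compared through their increments. *)
Lemma telescope_le (R : realType) (u v : nat -> R) :
  (forall n, u n - u n.+1 <= v n - v n.+1) ->
  u n @[n --> \oo] --> 0 -> v n @[n --> \oo] --> 0 ->
  forall n, u n <= v n.
Proof.
move=> uv u0 v0 n; rewrite -subr_ge0.
have mono : nonincreasing_seq (fun n => v n - u n).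
  by apply/nonincreasing_seqP => k; have := uv k; lra.
have c : (v n - u n) @[n --> \oo] --> 0 by rewrite -(subrr 0); exact: cvgB.
apply: (cvgr_to_le c); exists n => // k /= nk; exact: mono.
Qed.

(** The ratios of consecutive terms are at most [1/3], and [3/2] is the sum of the geometric series
    of ratio [1/3]. *)
Lemma beta_tail_le (R : realType) (n : nat) : beta_tail R n <= 3 / 2 * beta R n.
Proof.
apply: (@telescope_le _ (beta_tail R) (fun n => 3 / 2 * beta R n)) n.
- move=> n; rewrite beta_tailS betaS -mulrBr.
  have k0 : 0 <= n%:R :> R by rewrite ler0n.
  set r := (2 * _ + 1) / _; have hr : r <= 3^-1.
    by rewrite /r ler_pdivrMr; lra.
  have := beta_gt0 R n; set b := beta R n => b0.
  have : 0 <= b * (3^-1 - r) by rewrite mulr_ge0 ?subr_ge0// ltW.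
  by lra.
- exact: beta_tail_cvg.
- by rewrite -(mulr0 (3 / 2)); apply: cvgMl_tmp; exact: beta_cvg.
Qed.

(* [(6 n + 12) / (4 n + 11)] is [1 / (1 - r)] for the ratio
   [r = beta (n + 1) / beta n], which increases with [n]. *)
Lemma beta_tail_ge (R : realType) (n : nat) :
  beta R n * ((6 * n%:R + 12) / (4 * n%:R + 11)) <= beta_tail R n.
Proof.
pose u n := beta R n * ((6 * n%:R + 12) / (4 * n%:R + 11)).
apply: (@telescope_le _ u (beta_tail R)) n.
- move=> n; rewrite beta_tailS /u betaS -(natr1 n).
  have := ler0n R n; set x := n%:R => x0.
  (* In this form the increment of [u] is visibly at most [beta R n]. *)
  have -> : beta R n * ((6 * x + 12) / (4 * x + 11)) -
    beta R n * ((2 * x + 1) / (6 * (x + 2))) * ((6 * (x + 1) + 12) / (4 * (x + 1) + 11)) =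
    beta R n * (1 - (2 * x + 1) * 3 / ((4 * x + 11) * (4 * x + 15) * (x + 2))).
    field.
    by apply/andP; split; [|apply/andP; split]; apply/eqP; lra.
  apply: ler_piMr; first exact/ltW/beta_gt0.
  by rewrite gerBl divr_ge0// ?mulr_ge0//; lra.
- apply: (@squeeze_cvgr _ _ _ _ (fun=> 0) (fun n => 3 / 2 * beta R n)).
  + near=> n; have x0 := ler0n R n; have b0 := beta_gt0 R n.
    rewrite mulr_ge0 ?(ltW b0) ?divr_ge0//=; [|lra..].
    rewrite /u mulrC ler_pM2r// ler_pdivrMr; lra.
  + exact: cvg_cst.
  + by rewrite -(mulr0 (3 / 2)); apply: cvgMl_tmp; exact: beta_cvg.
- exact: beta_tail_cvg.
Unshelve. all: by end_near.
Qed.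

Lemma beta_tail_gt0 (R : realType) (n : nat) : 0 < beta_tail R n.
Proof.
apply: lt_le_trans (beta_tail_ge R n); have x0 := ler0n R n.
by rewrite mulr_gt0 ?beta_gt0// divr_gt0//; lra.
Qed.

(** The tail divided by its equivalent [(3/2) 3^(-n) n^(-3/2) / (sigma sqrt pi)], so that the limit
    is [1]. *)
Definition scaled_tail (R : realType) (n : nat) : R :=
  2 / 3 * sigma R * Num.sqrt pi * (n%:R * Num.sqrt n%:R) * 3 ^+ n * beta_tail R n.

(** The tail is compared with [beta R n], and [beta R n] with [g], the central binomial coefficient
    scaled to tend to [1], which the Wallis bounds control. *)
Lemma scaled_tail_bounds (R : realType) (n : nat) : (0 < n)%N ->
  1 - 3 / n%:R <= scaled_tail R n <= 1.
Proof.
move=> n0; have n0' : 0 < n%:R :> R by rewrite ltr0n.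
have n1' : 1 <= n%:R :> R by rewrite ler1n.
set A := n.+1%:R * catalan R n / 4 ^+ n.
have A0 : 0 < A by rewrite divr_gt0 ?exprn_gt0// mulr_gt0 ?ltr0n ?catalan_gt0.
set g := Num.sqrt (pi * n%:R) * A.
have pn0 : 0 < pi * n%:R :> R by rewrite mulr_gt0 ?pi_gt0.
have g0 : 0 < g by rewrite mulr_gt0// sqrtr_gt0.
have /andP[gl gu] : 2 * n%:R / (2 * n%:R + 1) <= g ^+ 2 <= 1.
  by rewrite /g exprMn sqr_sqrtr ?(ltW pn0)//; exact: catalan_wallis_bounds.
have g1 : g <= 1 by rewrite -(@expr_le1 _ 2)// ltW.
(* As [0 < g <= 1], a lower bound on [g^2] is one on [g]. *)
have gl' : 2 * n%:R / (2 * n%:R + 1) <= g.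
  by apply: le_trans gl _; rewrite expr2 ler_piMr// ltW.
have bE : 2 / 3 * sigma R * Num.sqrt pi * (n%:R * Num.sqrt n%:R) * 3 ^+ n * beta R n =
    2 / 3 * (g * (n%:R / (n%:R + 1))).
  rewrite betaE /g /A sqrtrM ?pi_ge0// -(natr1 n).
  have -> : 4 ^+ n = 12 ^+ n / 3 ^+ n :> R.
    by rewrite -expr_div_n; congr (_ ^+ _); field.
  rewrite expr_div_n expr1n.
  field.
  by rewrite natr1 !expf_neq0 ?pnatr_eq0//= lt0r_neq0 ?sigma_gt0.
set K := 2 / 3 * sigma R * Num.sqrt pi * (n%:R * Num.sqrt n%:R) * 3 ^+ n in bE *.
have K0 : 0 <= K.
  rewrite /K !mulr_ge0 ?sqrtr_ge0 ?exprn_ge0 ?(ltW (sigma_gt0 R))// ltW//.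
have -> : scaled_tail R n = K * beta_tail R n by [].
apply/andP; split; last first.
  apply: (@le_trans _ _ (K * (3 / 2 * beta R n))).
    by rewrite ler_wpM2l ?beta_tail_le.
  rewrite mulrCA bE mulrA.
  rewrite [_ * (2 / 3)](_ : _ = 1); last by field.
  rewrite mul1r; apply: mulr_ile1 => //; first exact: ltW.
  by rewrite ler_pdivrMr; lra.
apply: (@le_trans _ _ (K * (beta R n * ((6 * n%:R + 12) / (4 * n%:R + 11))))); last first.
  by rewrite ler_wpM2l ?beta_tail_ge.
rewrite mulrA bE.
move: n%:R n0' n1' gl' => x x0 x1 gl'.
apply: (@le_trans _ _ (2 / 3 * (2 * x / (2 * x + 1) * (x / (x + 1))) *
    ((6 * x + 12) / (4 * x + 11)))); last first.
  apply: ler_wpM2r; first by apply: divr_ge0; lra.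
  by apply: ler_wpM2l => //; apply: ler_wpM2r => //; apply: divr_ge0; lra.
(* The subtracted fraction is of order [9 / (4 x)], so the bound [3 / x] has room to spare. *)
have -> : 2 / 3 * (2 * x / (2 * x + 1) * (x / (x + 1))) * ((6 * x + 12) / (4 * x + 11)) =
    1 - ((18 * x ^+ 2 + 37 * x + 11) / ((2 * x + 1) * (x + 1) * (4 * x + 11))).
  field.
  by apply/andP; split; [|apply/andP; split]; apply/eqP; lra.
rewrite lerB// ler_pdivrMr ?mulr_gt0//; [|lra..].
rewrite mulrAC ler_pdivlMr//.
nra.
Qed.

(** * The law of the maximum *)

Lemma sum_beta (R : realType) (a n : nat) :
  \sum_(i < n) beta R (a + i) = beta_tail R a - beta_tail R (a + n).
Proof.
elim: n => [|n IH]; first by rewrite big_ord0 addn0 subrr.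
by rewrite big_ord_recr/= IH addnS -beta_tailS addrA subrK.
Qed.

Lemma beta_sum1 (R : realType) : (\sum_(1 <= k <oo) (beta R k)%:E = 1)%E.
Proof.
apply/cvg_lim => //.
rewrite -(cvg_shiftS (fun n => \sum_(1 <= k < n) (beta R k)%:E)%E) /=.
have -> : (fun n => \sum_(1 <= k < n.+1) (beta R k)%:E)%E =
    (fun n => (1 - beta_tail R n.+1)%:E).
  apply/funext => n; rewrite sumEFin big_add1 big_mkord.
  under eq_bigr do rewrite -add1n.
  by rewrite sum_beta beta_tail1 add1n.
apply: cvg_EFin; first by apply: nearW.
rewrite -[X in _ --> X](subr0 1); apply: cvgB; first exact: cvg_cst.
by rewrite (cvg_shiftS (beta_tail R)); exact: beta_tail_cvg.
Qed.

Lemma measurable_preimage_RV (R : realType) (d : measure_display)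
    (T : measurableType d) (P : probability T R) (X : {RV P >-> R}) (A : set R) :
  measurable A -> measurable (X @^-1` A).
Proof. by move=> mA; rewrite -[X in measurable X]setTI; exact: measurable_funPT. Qed.

(** The events [X = k] with [a <= k < a + n] are disjoint and contained in [A]. *)
Lemma beta_mass_le (R : realType) (d : measure_display) (T : measurableType d)
    (P : probability T R) (X : {RV P >-> R})
    (a n : nat) (A : set T) :
  (forall k : nat, (0 < k)%N -> P [set t | X t = k%:R] = (beta R k)%:E) ->
  (0 < a)%N -> measurable A ->
  (forall k t, (a <= k < a + n)%N -> X t = k%:R -> A t) ->
  ((beta_tail R a - beta_tail R (a + n))%:E <= P A)%E.
Proof.
move=> Xdist a0 mA XA.
pose F (i : nat) := [set t | X t = (a + i)%:R].
have mF i : measurable (F i) by exact: (@measurable_preimage_RV _ _ _ P X _ (measurable_set1 _)).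
have dF : trivIset setT F.
  apply/trivIsetP => i j _ _ ij; rewrite -subset0 => t [Fi Fj].
  have /eqP : (a + i)%:R = (a + j)%:R :> R by rewrite -[LHS]Fi.
  by rewrite eqr_nat eqn_add2l (negbTE ij).
have -> : (beta_tail R a - beta_tail R (a + n))%:E = P (\big[setU/set0]_(i < n) F i).
  rewrite measure_bigsetU//.
  rewrite -sum_beta -sumEFin; apply: eq_bigr => i _.
  by rewrite -Xdist// addn_gt0 a0.
apply: le_measure; rewrite ?inE//; first exact: bigsetU_measurable.
move=> t; rewrite -bigcup_mkord => -[i /= ltin Ft]; apply: XA Ft.
by rewrite leq_addr ltn_add2l.
Qed.

(** The values below [n] bound this probability from below; those from [n] to [n + N - 1], as [N]
    grows, bound the complement from below. The two bounds sum to one. *)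
Lemma beta_cdf (R : realType) (d : measure_display) (T : measurableType d)
    (P : probability T R) (X : {RV P >-> R}) (n : nat) :
  (forall k : nat, (0 < k)%N -> P [set t | X t = k%:R] = (beta R k)%:E) ->
  (0 < n)%N ->
  P [set t | X t < n%:R] = (1 - beta_tail R n)%:E.
Proof.
move=> Xdist n0; set A := [set t | _].
have mA : measurable A.
  rewrite (_ : A = X @^-1` `]-oo, n%:R[).
    exact: measurable_preimage_RV.
  by apply/seteqP; split => t /=; rewrite in_itv.
apply/eqP; rewrite eq_le; apply/andP; split; last first.
  have := @beta_mass_le _ _ _ _ _ 1 n.-1 _ Xdist isT mA.
  rewrite add1n prednK// beta_tail1; apply => k t /andP[_ kn] Xk.
  by rewrite /A/= Xk ltr_nat.
have mCA : measurable (~` A) by exact: measurableC.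
have ub N : ((beta_tail R n - beta_tail R (n + N))%:E <= P (~` A))%E.
  apply: (beta_mass_le Xdist) => // k t /andP[nk _] Xk.
  by rewrite /A/= Xk; apply/negP; rewrite -leNgt ler_nat.
rewrite probability_setC// in ub.
have Pfin : P A \is a fin_num by exact: fin_num_measure.
move: ub; rewrite -(fineK Pfin); set p := fine _ => ub.
rewrite lee_fin.
have c0 : beta_tail R (n + N) @[N --> \oo] --> 0.
  rewrite (_ : (fun _ => _) = [sequence beta_tail R (N + n)]_N); last first.
    by apply/funext => N; rewrite addnC.
  by rewrite (cvg_shiftn n (beta_tail R)); exact: beta_tail_cvg.
have c : p + (beta_tail R n - beta_tail R (n + N)) @[N --> \oo] --> p + (beta_tail R n - 0).
  apply: cvgD; first exact: cvg_cst.
  apply: cvgB; first exact: cvg_cst.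
  exact: c0.
have : p + (beta_tail R n - 0) <= 1.
  apply: (cvgr_to_le c); apply: nearW => N.
  by have := ub N; rewrite -EFinB lee_fin; lra.
by lra.
Qed.

Lemma max_RV_lt (R : realType) (d : measure_display) (T : measurableType d)
    (P : probability T R) (m : nat) (X : 'I_m -> {RV P >-> R}) (y : R) :
  [set t | (max_RV X t < y%:E)%E] =
  \bigcap_(i in [set` [set: 'I_m]%SET]) (X i @^-1` `]-oo, y[).
Proof.
apply/seteqP; split => t /=.
  move=> h i _ /=; rewrite in_itv/= -lte_fin; apply: le_lt_trans h.
  exact: (le_bigmax _ (fun i => (X i t)%:E) i).
(* The initial value [-oo] is itself below [y], which covers the empty family. *)
move=> h; apply/bigmax_ltP; split; first exact: ltNyr.
move=> i _; rewrite lte_fin; have := h i; rewrite /= in_itv/= inE; exact.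
Qed.

Lemma max_beta_cdf (R : realType) (d : measure_display) (T : measurableType d)
    (P : probability T R) (m n : nat) (X : 'I_m -> {RV P >-> R}) :
  mutually_independent X ->
  (forall i k, (0 < k)%N -> P [set t | X i t = k%:R] = (beta R k)%:E) ->
  (0 < n)%N ->
  P [set t | (max_RV X t < (n%:R)%:E)%E] = ((1 - beta_tail R n) ^+ m)%:E.
Proof.
move=> indX dX n0.
rewrite max_RV_lt (indX [set: 'I_m]%SET (fun=> `]-oo, n%:R[%classic)); last by move=> i _; exact: measurable_itv.
under eq_bigr => i _.
  rewrite (_ : _ @^-1` _ = [set t | X i t < n%:R]); last first.
    by apply/seteqP; split => t /=; rewrite in_itv.
  rewrite (beta_cdf (dX i))//.
  over.
rewrite prodEFin; congr (_%:E).
by rewrite prodr_const cardsT card_ord.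
Qed.

(** * Asymptotics *)

(** Both bounds are [1 + t <= exp t], at [t = - q] and at [t = q / (1 - q)], where
    [1 + t = 1 / (1 - q)]. *)
Lemma expR_le_onemX (R : realType) (q : R) (m : nat) : 0 <= q < 1 ->
  expR (- (m%:R * (q / (1 - q)))) <= (1 - q) ^+ m <= expR (- (m%:R * q)).
Proof.
move=> /andP[q0 q1]; have q1' : 0 < 1 - q by lra.
rewrite -!(mulrN m%:R) !expRM_natl.
have lb : expR (- (q / (1 - q))) <= 1 - q.
  rewrite expRN -[leRHS]invrK lef_pV2 ?posrE ?expR_gt0 ?invr_gt0//.
  apply: le_trans (expR_ge1Dx _).
  by rewrite le_eqVlt; apply/orP; left; apply/eqP; field; rewrite lt0r_neq0.
have ub : 1 - q <= expR (- q) by have := expR_ge1Dx (- q).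
by apply/andP; split; apply: lerXn2r; rewrite ?nnegrE ?expR_ge0 ?(ltW q1').
Qed.

Lemma dist_expR1_le (R : realType) (y e : R) : 0 < e -> `|y| <= ln (1 + e) ->
  `|expR y - 1| <= e.
Proof.
move=> e0; have e1 : 0 < 1 + e by lra.
rewrite ler_norml => /andP[yl yu].
have E : expR (ln (1 + e)) = 1 + e by rewrite lnK.
have hu : expR y <= 1 + e by rewrite -E ler_expR.
have hl : (1 + e)^-1 <= expR y by rewrite -[in leLHS]E -expRN ler_expR.
have hi : 1 - e <= (1 + e)^-1.
  by rewrite -[leRHS]mul1r ler_pdivlMr//; have := sqr_ge0 e; rewrite expr2; lra.
by rewrite ler_norml; apply/andP; split; lra.
Qed.

(** The quotient lies between [exp (- l eta)] and [exp (l eta)]. The uniform bound [c] on [l] lets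
    [eta] depend on [e] and [c] alone. *)
Lemma onemX_expR_ratio (R : realType) (q l c e eta : R) (m : nat) : 0 <= q < 1 ->
  0 < e -> 0 <= l <= c -> c * eta <= ln (1 + e) ->
  l * (1 - eta) <= m%:R * q -> m%:R * (q / (1 - q)) <= l * (1 + eta) -> 0 <= eta ->
  `|(1 - q) ^+ m / expR (- l) - 1| <= e.
Proof.
move=> hq e0 /andP[l0 lc] ceta lo hi eta0.
have /andP[h1 h2] := expR_le_onemX m hq.
have le_ln : l * eta <= ln (1 + e) by apply: le_trans ceta; rewrite ler_wpM2r.
have hu : `|expR (l * eta) - 1| <= e by apply: dist_expR1_le; rewrite // ger0_norm ?mulr_ge0.
have hl : `|expR (- (l * eta)) - 1| <= e.
  by apply: dist_expR1_le; rewrite // normrN ger0_norm ?mulr_ge0.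
rewrite expRN invrK.
have u : (1 - q) ^+ m * expR l <= expR (l * eta).
  apply: (@le_trans _ _ (expR (- (m%:R * q)) * expR l)); first by rewrite ler_wpM2r ?expR_ge0.
  by rewrite -expRD ler_expR; lra.
have l' : expR (- (l * eta)) <= (1 - q) ^+ m * expR l.
  apply: (@le_trans _ _ (expR (- (m%:R * (q / (1 - q)))) * expR l)); last first.
    by rewrite ler_wpM2r ?expR_ge0.
  by rewrite -expRD ler_expR; lra.
move: hu hl; rewrite !ler_norml => /andP[_ ?] /andP[? _].
by apply/andP; split; lra.
Qed.

(** The root of [r] stays in the same interval, because [(1 - b)^2 <= 1 - b] and
    [1 + b <= (1 + b)^2]. *)
Lemma mulr_sqrt_bounds (R : realType) (r b : R) : 0 <= b <= 1 ->
  1 - b <= r <= 1 + b -> (1 - b) ^+ 2 <= r * Num.sqrt r <= (1 + b) ^+ 2.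
Proof.
move=> /andP[b0 b1] /andP[rl ru].
have r0 : 0 <= r by lra.
have s0 := sqrtr_ge0 r; have s2 := sqr_sqrtr r0.
have su : Num.sqrt r <= 1 + b.
  by rewrite -(@ler_sqr _ _ (1 + b)) ?nnegrE ?s2; nra.
have sl : 1 - b <= Num.sqrt r.
  by rewrite -(@ler_sqr _ (1 - b)) ?nnegrE ?s2; nra.
by rewrite !expr2 !ler_pM//; lra.
Qed.

Lemma cvg_invn (R : realType) : (n%:R^-1 : R) @[n --> \oo] --> 0.
Proof. by rewrite -(cvg_shiftS (fun n => n%:R^-1 : R)); exact: cvg_harmonic. Qed.

Lemma powR32 (R : realType) (x : R) : 0 < x -> x `^ (- (3 / 2)) = (x * Num.sqrt x)^-1.
Proof.
move=> x0; rewrite powRN; congr (_^-1).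
have -> : 3 / 2 = 1 + 2^-1 :> R by field.
by rewrite powRD ?(gt_eqF x0) ?implybT// powRr1 ?ltW// powR12_sqrt ?ltW.
Qed.

Lemma gammaE_size (R : realType) (m : nat) (g : R) : 0 < g ->
  m%:R * (g `^ (- (3 / 2))) * (3 `^ (- g)) / (sigma R * Num.sqrt pi) = 1 ->
  m%:R = sigma R * Num.sqrt pi * (g * Num.sqrt g) * 3 `^ g.
Proof.
move=> g0; rewrite powR32// powRN => H.
have sg := sigma_gt0 R.
have sp : 0 < Num.sqrt pi :> R by rewrite sqrtr_gt0 pi_gt0.
have sq : 0 < Num.sqrt g by rewrite sqrtr_gt0.
have p3 : 0 < 3 `^ g by rewrite powR_gt0.
rewrite -[RHS]mulr1 -[X in _ = _ * X]H.
set k := m%:R; field.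
by rewrite !lt0r_neq0.
Qed.

(** Eliminating [m] by [gammaE_size] isolates the limit [3^(1-x)/2] from two corrections that tend
    to [1]: the scaled tail and [(g / n)^(3/2)]. *)
Lemma size_tail (R : realType) (m n : nat) (g x : R) : (0 < n)%N -> 0 < g ->
  m%:R * (g `^ (- (3 / 2))) * (3 `^ (- g)) / (sigma R * Num.sqrt pi) = 1 ->
  x + g = n%:R ->
  m%:R * beta_tail R n =
  3 `^ (1 - x) / 2 * (scaled_tail R n * (g / n%:R * Num.sqrt (g / n%:R))).
Proof.
move=> n0 g0 gE xg.
have n0' : 0 < n%:R :> R by rewrite ltr0n.
have -> : 1 - x = 1 + g - n%:R by lra.
have ne3 : 3 != 0 :> R by rewrite pnatr_eq0.
rewrite powRB ?ne3 ?implybT// powRD ?ne3 ?implybT// powRr1// powR_mulrn//.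
rewrite (gammaE_size g0 gE) /scaled_tail.
rewrite sqrtrM ?ltW// sqrtrV ?ltW//.
have sq : Num.sqrt n%:R != 0 :> R by rewrite lt0r_neq0// sqrtr_gt0.
by field; rewrite sq lt0r_neq0//= expf_neq0.
Qed.

(** The expression of [m] in [gammaE_size] increases with [gamma m], so [gamma m < G] would bound
    [m]. *)
Lemma gamma_unbounded (R : realType) (gamma : nat -> R) :
  (forall m : nat, (0 < m)%N -> 0 < gamma m) ->
  (forall m : nat, (0 < m)%N ->
     m%:R * (gamma m `^ (- (3 / 2))) * (3 `^ (- gamma m))
       / (sigma R * Num.sqrt pi) = 1) ->
  forall G : R, 0 <= G -> \forall m \near \oo, G <= gamma m.
Proof.
move=> g0 gE G G0; near=> m.
have m0 : (0 < m)%N by near: m; exact: nbhs_infty_gt.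
have mK : sigma R * Num.sqrt pi * (G * Num.sqrt G) * 3 `^ G < m%:R.
  by near: m; exact: nbhs_infty_gtr.
rewrite leNgt; apply/negP => gG; move: mK; apply/negP; rewrite -leNgt.
have gm0 := g0 _ m0.
rewrite (gammaE_size gm0 (gE _ m0)).
have sp : 0 <= sigma R * Num.sqrt pi by rewrite mulr_ge0 ?sqrtr_ge0 ?(ltW (sigma_gt0 R)).
apply: ler_pM.
- by rewrite mulr_ge0// mulr_ge0 ?sqrtr_ge0// ltW.
- exact: powR_ge0.
- by rewrite ler_wpM2l// ler_pM ?sqrtr_ge0 ?ler_sqrt ?(ltW gm0) ?(ltW gG).
- by rewrite ler_powR ?(ltW gG)// ler1n.
Unshelve. all: by end_near.
Qed.

(** Uniformity: [x] enters only through [g / n], which lies within [B / n] of [1], so the threshold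
    on [n] is fixed before [m], [g] and [x]. *)
Lemma size_tail_bounds (R : realType) (B eta : R) : 0 <= B -> 0 < eta ->
  \forall n \near \oo, forall (m : nat) (g x : R), `|x| <= B -> 0 < g ->
    m%:R * (g `^ (- (3 / 2))) * (3 `^ (- g)) / (sigma R * Num.sqrt pi) = 1 ->
    x + g = n%:R ->
    [/\ beta_tail R n < 1, 3 `^ (1 - x) / 2 * (1 - eta) <= m%:R * beta_tail R n &
      m%:R * (beta_tail R n / (1 - beta_tail R n)) <= 3 `^ (1 - x) / 2 * (1 + eta)].
Proof.
move=> B0 eta0.
have invc (c : R) : c / n%:R @[n --> \oo] --> 0.
  by rewrite -(mulr0 c); apply: cvgMl_tmp; exact: cvg_invn.
have sqc (c s : R) : (1 + s * (c / n%:R)) ^+ 2 @[n --> \oo] --> (1 : R).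
  have h : 1 + s * (c / n%:R) @[n --> \oo] --> (1 : R).
    rewrite -[X in _ --> X]addr0 -(mulr0 s); apply: cvgD; first exact: cvg_cst.
    by apply: cvgMl_tmp; exact: invc.
  by rewrite -[X in _ --> X]mulr1; under eq_fun do rewrite expr2; exact: cvgM.
have loc : (1 - 3 / n%:R) * (1 + -1 * (B / n%:R)) ^+ 2 @[n --> \oo] --> (1 : R).
  rewrite -[X in _ --> X]mulr1; apply: cvgM; last exact: sqc.
  by rewrite -[X in _ --> X]subr0; apply: cvgB; [exact: cvg_cst|exact: invc].
have hic : (1 + 1 * (B / n%:R)) ^+ 2 / (1 - beta_tail R n) @[n --> \oo] --> (1 : R).
  rewrite -[X in _ --> X]divr1; apply: cvgM; first exact: sqc.
  apply: cvgV; first by rewrite oner_neq0.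
  by rewrite -[X in _ --> X]subr0; apply: cvgB; [exact: cvg_cst|exact: beta_tail_cvg].
near=> n => m g x xB g0 gE xg.
have n0 : (0 < n)%N by near: n; exact: nbhs_infty_gt.
have n0' : 0 < n%:R :> R by rewrite ltr0n.
have q1 : beta_tail R n < 1.
  by near: n; apply: (cvgr_lt _ (@beta_tail_cvg R)); exact: ltr01.
(* This makes [1 - 3 / n] nonnegative, so that lower bounds can be multiplied. *)
have n3 : 3 < n%:R :> R by near: n; exact: nbhs_infty_gtr.
have nB : B < n%:R by near: n; exact: nbhs_infty_gtr.
have lo : 1 - eta <= (1 - 3 / n%:R) * (1 + -1 * (B / n%:R)) ^+ 2.
  by near: n; apply: (cvgr_ge _ loc); lra.
have hi : (1 + 1 * (B / n%:R)) ^+ 2 / (1 - beta_tail R n) <= 1 + eta.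
  by near: n; apply: (cvgr_le _ hic); lra.
have b01 : 0 <= B / n%:R <= 1.
  by rewrite divr_ge0 ?(ltW n0')//= ler_pdivrMr// mul1r ltW.
have rb : 1 - B / n%:R <= g / n%:R <= 1 + B / n%:R.
  have -> : g = n%:R - x by lra.
  rewrite mulrBl divff ?lt0r_neq0// lerD2l lerN2 lerD2l -mulNr !ler_pM2r ?invr_gt0//.
  by move: xB; rewrite ler_norml => /andP[? ?]; apply/andP; split; lra.
have /andP[wl wu] := mulr_sqrt_bounds b01 rb.
have /andP[Fl Fu] := scaled_tail_bounds R n0.
rewrite mul1r in hi; rewrite mulN1r in lo.
have e3 : 0 <= 1 - 3 / n%:R :> R by rewrite subr_ge0 ler_pdivrMr// mul1r ltW.
have l0 : 0 <= 3 `^ (1 - x) / 2 :> R by rewrite divr_ge0 ?powR_ge0.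
split=> //.
  rewrite (size_tail n0 g0 gE xg) ler_wpM2l//; apply: le_trans lo _.
  by rewrite ler_pM// sqr_ge0.
rewrite mulrA (size_tail n0 g0 gE xg) -mulrA ler_wpM2l//; apply: le_trans hi.
rewrite ler_wpM2r ?invr_ge0 ?subr_ge0 ?(ltW q1)//.
apply: le_trans wu; rewrite ler_piMl//.
by apply: le_trans wl; exact: sqr_ge0.
Unshelve. all: by end_near.
Qed.

Theorem theorem4 (R : realType)
  (d : nat -> measure_display) (T : forall m : nat, measurableType (d m))
  (P : forall m : nat, probability (T m) R)
  (Y : forall m : nat, 'I_m -> {RV (P m) >-> R})
  (Yint : forall (m : nat) (i : 'I_m) (t : T m), Y m i t \is a Num.int)
  (Yindep : forall m : nat, mutually_independent (Y m))
  (Ydist : forall (m : nat) (i : 'I_m) (k : nat), (0 < k)%N ->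
     P m [set t | Y m i t = k%:R] = (beta R k)%:E)
  (gamma : nat -> R)
  (gamma_gt0 : forall m : nat, (0 < m)%N -> 0 < gamma m)
  (gammaE : forall m : nat, (0 < m)%N ->
     m%:R * (gamma m `^ (- (3 / 2))) * (3 `^ (- gamma m))
       / (sigma R * Num.sqrt pi) = 1) :
  ((forall k : nat, (0 < k)%N -> 0 <= beta R k) /\
   (\sum_(1 <= k <oo) (beta R k)%:E = 1)%E) /\
  (forall B e : R, 0 < e ->
   exists M : nat, forall m : nat, (M <= m)%N ->
   forall x : R, `|x| <= B -> x + gamma m \is a Num.int ->
   `| fine (P m [set t | (max_RV (Y m) t < (x + gamma m)%:E)%E])
      / expR (- (3 `^ (1 - x)) / 2) - 1 | <= e).
Proof.
split; first by split=> [k _|]; [exact/ltW/beta_gt0|exact: beta_sum1].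
move=> B e e0.
have [B0|B0] := leP 0 B; last first.
  by exists 0%N => m _ x xB; move: (le_lt_trans xB B0); rewrite normr_lt0.
(* The largest value of [3^(1-x)/2] for [|x| <= B]; [eta] then satisfies [c * eta = ln (1 + e)]. *)
pose c : R := 3 `^ (1 + B) / 2.
have c0 : 0 < c by rewrite divr_gt0// powR_gt0.
pose eta := ln (1 + e) / c.
have eta0 : 0 < eta by rewrite divr_gt0// ln_gt0; lra.
have [N _ HN] := size_tail_bounds B0 eta0.
(* Once [gamma m >= N + 1 + B], the integer [x + gamma m] is a natural number [n > N], as
   [x >= - B]. *)
have NB0 : 0 <= N.+1%:R + B by rewrite addr_ge0.
have [M _ HM] := gamma_unbounded gamma_gt0 gammaE NB0.
exists M.+1 => m Mm x xB.
have m0 : (0 < m)%N by apply: leq_trans Mm.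
have gN : N.+1%:R + B <= gamma m by apply: HM; exact: ltnW.
have xg : N.+1%:R <= x + gamma m by move: xB; rewrite ler_norml => /andP[? _]; lra.
rewrite intrEge0 => [/natrP[n nE]|]; last exact: le_trans xg.
have Nn : (N < n)%N by rewrite -(ler_nat R) -nE.
have [q1 lo hi] := HN n (ltnW Nn) m _ x xB (gamma_gt0 _ m0) (gammaE _ m0) nE.
rewrite nE (max_beta_cdf (Yindep m) (Ydist m) (leq_ltn_trans (leq0n N) Nn)) mulNr.
apply: (onemX_expR_ratio (c := c) (eta := eta)) => //.
- by rewrite q1 ltW ?beta_tail_gt0.
- rewrite divr_ge0 ?powR_ge0//= ler_pM2r ?invr_gt0// ler_powR ?ler1n//.
  by move: xB; rewrite ler_norml => /andP[? _]; lra.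
- by rewrite /eta mulrC divfK ?lt0r_neq0.
- exact: ltW.
Qed.
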